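(* Let $S\subseteq\mathbb{R}^n$ be a rigidly convex set. Then every face of $S$ is exposed.
   Context: A polynomial $p\in\mathbb{R}[t_1,\dots,t_n]$ is called a real zero polynomial with respect to $e\in\mathbb{R}^n$ (an $\mathrm{RZ}_e$-polynomial) if $p(e)>0$ and, for every $v\in\mathbb{R}^n\setminus\{0\}$, all (complex) zeros of the univariate polynomial $p(e+sv)\in\mathbb{R}[s]$ are real. A set $S\subseteq\mathbb{R}^n$ is called rigidly convex if there exist $e\in S$ and an $\mathrm{RZ}_e$-polynomial $p$ such that $S$ is the closure of the connected component of $\{x\in\mathbb{R}^n \mid p(x)>0\}$ containing $e$. Rigidly convex sets are known to be convex (and they are closed with non-empty interior by definition). Let $S$ be a closed convex subset of $\mathbb{R}^n$ with non-empty interior. A supporting hyperplane of $S$ is an affine hyperplane $H\subseteq\mathbb{R}^n$ such that $S\cap H\neq\emptyset$ and $S\setminus H$ is connected (equivalently, $H$ is the zero set of a polynomial $\ell\neq 0$ of degree at most $1$ with $\ell\geq 0$ on $S$ and $\{\ell=0\}\cap S\neq\emptyset$). A face of $S$ is a non-empty convex subset $F\subseteq S$ such that for all $x,y\in S$ and $\lambda\in(0,1)$, if $\lambda x+(1-\lambda)y\in F$ then $x,y\in F$. A face $F$ of $S$ is exposed if either $F=S$ or there is a supporting hyperplane $H$ of $S$ with $H\cap S=F$. *)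

(* Defs.v *)
From HB Require Import structures.
From mathcomp Require Import all_boot all_order all_algebra.
From mathcomp Require Import all_classical all_reals all_analysis.
From mathcomp Require Import complex.
(* The notations of mpoly have levels incompatible with those of analysis. *)
From mathcomp Require Import -(notations) mpoly.
Set Implicit Arguments.
Unset Strict Implicit.
Unset Printing Implicit Defensive.
Import Order.TTheory GRing.Theory Num.Theory.
Import numFieldNormedType.Exports.
Local Open Scope classical_set_scope.
Local Open Scope ring_scope.

Definition peval (R : realType) (n : nat) (p : mpoly n R)
    (x : 'rV[R]_n) : R :=
  meval (fun i => x 0 i) p.

(* The univariate polynomial p(e + s v), in which 'X plays the role of s. *)
Definition line_poly (R : realType) (n : nat) (p : mpoly n R)
    (e v : 'rV[R]_n) : {poly R} :=
  mmap (@polyC R) (fun i => (e 0 i)%:P + (v 0 i)%:P * 'X) p.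

Lemma horner_line_poly (R : realType) (n : nat) (p : mpoly n R)
    (e v : 'rV[R]_n) (s : R) :
  (line_poly p e v).[s] = peval p (e + s *: v).
Proof.
rewrite /line_poly /peval mevalE /mmap horner_sum; apply: eq_bigr => m _.
rewrite hornerM hornerC /mmap1 horner_prod; congr (_ * _).
by apply: eq_bigr => i _; rewrite horner_exp !hornerE !mxE (mulrC s).
Qed.

Definition real_zero_poly (R : realType) (n : nat) (e : 'rV[R]_n)
    (p : mpoly n R) : Prop :=
  0 < peval p e /\
  forall v : 'rV[R]_n, v != 0 ->
  forall z : R[i], root (map_poly (real_complex R) (line_poly p e v)) z ->
    z \is Num.real.

Definition rigidly_convex (R : realType) (n : nat) (S : set 'rV[R]_n) : Prop :=
  exists (e : 'rV[R]_n) (p : mpoly n R),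
    [/\ S e, real_zero_poly e p &
        S = closure (connected_component [set x | 0 < peval p x] e)].

Definition affine_hyperplane (R : realType) (n : nat) (H : set 'rV[R]_n) :
    Prop :=
  exists (a : 'rV[R]_n) (b : R),
    a != 0 /\ H = [set x | \sum_(i < n) a 0 i * x 0 i = b].

Definition supporting_hyperplane (R : realType) (n : nat)
    (S H : set 'rV[R]_n) : Prop :=
  [/\ affine_hyperplane H, S `&` H !=set0 & connected (S `\` H)].

Definition is_face (R : realType) (n : nat) (S F : set 'rV[R]_n) : Prop :=
  [/\ F !=set0, convex_set F, F `<=` S &
      forall (x y : 'rV[R]_n) (l : R), S x -> S y -> 0 < l -> l < 1 ->
        F (l *: x + (1 - l) *: y) -> F x /\ F y].

Definition exposed_face (R : realType) (n : nat) (S F : set 'rV[R]_n) : Prop :=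
  is_face S F /\
  (F = S \/ exists H : set 'rV[R]_n, supporting_hyperplane S H /\ H `&` S = F).

(* Main.v *)
From HB Require Import structures.
Require Import Defs.
From mathcomp Require Import all_boot all_order all_algebra.
From mathcomp Require Import all_classical all_reals all_analysis.
From mathcomp Require Import complex ring lra.
From mathcomp Require Import -(notations) mpoly.

(* Let p be RZ_e with S = closure of C, C the component of e in {p > 0}. Real
   zeros of p on lines through e are stable under limits (a real-rooted
   polynomial is bounded below away from its roots), so C is star-shaped about
   e; Gårding's root-homotopy argument shows that p is RZ_a for every a in C.
   Hence, for a in C and y in S, p(a + s(y - a)) = p(a) prod_i (1 + c_i s) with
   all c_i >= -1.

   Given a face F, choose x in F for which the order of vanishing m at t = 0 of
   phi_x(t) = p(x + t(e - x)) is least, and suppose m > 0 (otherwise F = S).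
   The coefficient L(u) of t^(m-1) in the derivative of p at x + t(e - x) along
   u is linear in u. The product formula along the segments between the points
   x + t(e - x) and y + t(e - y), where sum_i c_i is the logarithmic derivative
   in direction y - x, yields as t -> 0:
   - L(y - x) >= 0 for y in S, and L(e - x) > 0;
   - if L(y - x) = 0 then the c_i stay bounded, so S contains a point
     x - eta (y - x) with eta > 0, whence y is in F;
   - if L(y - x) > 0 then the midpoint of x and y has order of vanishing < m,
     so y is not in F.
   Thus {z | L(z - x) = 0} exposes F. *)

Set Implicit Arguments.
Unset Strict Implicit.
Unset Printing Implicit Defensive.
Import Order.TTheory GRing.Theory Num.Theory.
Import numFieldNormedType.Exports.
Local Open Scope classical_set_scope.
Local Open Scope ring_scope.

(** * Polynomials along lines *)

(** Evaluation and differentiation have rules for sums and products, so the bounds and identities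
    below need checking only on constants and variables. *)
Lemma mpoly_ring_ind (n : nat) (A : comNzRingType) (P : mpoly n A -> Prop) :
  (forall c, P (mpolyC n c)) ->
  (forall i, P (mpolyX A (mnm1 i))) ->
  (forall p q, P p -> P q -> P (p + q)) ->
  (forall p q, P p -> P q -> P (p * q)) ->
  forall p, P p.
Proof.
move=> PC PX PD PM p; have PXm m : P (mpolyX A m).
  rewrite mpolyXE_id; elim/big_ind: _ => [||i _]; last 1 first.
  - by elim: (m i) => [|k IH]; rewrite ?expr0 ?exprS; [exact: (PC 1)|apply: PM].
  - exact: (PC 1).
  - exact: PM.
elim/mpolyind: p => [|c m p _ _ Pp]; first exact: (PC 0).
by apply: PD => //; rewrite -mul_mpolyC; apply: PM.
Qed.

Section ComplexEvaluation.
Context {R : realType} {n : nat}.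
Implicit Types (p : mpoly n R) (a u x y : 'I_n -> R[i]).
Local Notation rc := (real_complex R).

Definition ceval p x : R[i] := mmap rc x p.

(** The direction may be complex: the homotopy below perturbs a real direction by an imaginary
    multiple of [a - e]. *)
Definition cline p a u : {poly R[i]} :=
  mmap (@polyC R[i] \o rc) (fun i => (a i)%:P + (u i)%:P * 'X) p.

Lemma horner_cline p a u z : (cline p a u).[z] = ceval p (fun i => a i + z * u i).
Proof.
rewrite /cline /ceval /mmap horner_sum; apply: eq_bigr => m _ /=.
rewrite hornerM hornerC /mmap1 horner_prod; congr (_ * _).
by apply: eq_bigr => i _; rewrite horner_exp !hornerE (mulrC z).
Qed.

Lemma ceval_real p (x : 'rV[R]_n) : ceval p (fun i => rc (x 0 i)) = rc (peval p x).
Proof.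
rewrite /ceval /peval mevalE /mmap rmorph_sum; apply: eq_bigr => m _ /=.
by rewrite rmorphM /mmap1 rmorph_prod; congr (_ * _);
   apply: eq_bigr => i _; rewrite rmorphXn.
Qed.

Lemma map_line_poly p (e v : 'rV[R]_n) :
  map_poly rc (line_poly p e v) =
  cline p (fun i => rc (e 0 i)) (fun i => rc (v 0 i)).
Proof.
rewrite /line_poly /cline /mmap rmorph_sum; apply: eq_bigr => m _ /=.
rewrite rmorphM /= map_polyC /= /mmap1 rmorph_prod; congr (_ * _).
by apply: eq_bigr => i _;
   rewrite rmorphXn rmorphD rmorphM /= !map_polyC map_polyX.
Qed.

(** One [d] for all [a] and [u] makes the estimate [horner_lower_bound] uniform over families of
    lines. *)
Lemma size_cline p : exists d, forall a u, (size (cline p a u) <= d.+1)%N.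
Proof.
elim/mpoly_ring_ind: p => [c|i|p q [d1 h1] [d2 h2]|p q [d1 h1] [d2 h2]].
- by exists 0%N => a u; rewrite /cline mmapC /= size_polyC; case: (_ != _).
- exists 1%N => a u; rewrite /cline mmapX mmap1U.
  apply: (leq_trans (size_polyD _ _)); rewrite geq_max size_polyC.
  rewrite (leq_trans (leq_b1 _)) //=.
  by apply: (leq_trans (size_polyMleq _ _)); rewrite size_polyC size_polyX; case: (_ != _).
- exists (maxn d1 d2) => a u; rewrite /cline mmapD.
  apply: (leq_trans (size_polyD _ _)).
  by rewrite -maxnSS geq_max !leq_max h1 h2 orbT.
- exists (d1 + d2)%N => a u; rewrite /cline rmorphM /=.
  apply: (leq_trans (size_polyMleq _ _)).
  by have := leq_add (h1 a u) (h2 a u); rewrite addSn addnS; case: (_ + _)%N.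
Qed.

(** The bound on the values is carried along because the product case of the Lipschitz bound needs
    it. *)
Lemma ceval_lipschitz p (M : R[i]) : 0 <= M -> exists2 K : R[i], 0 <= K &
  forall x y (d : R[i]), (forall i, `|x i| <= M) -> (forall i, `|y i| <= M) ->
    0 <= d -> (forall i, `|x i - y i| <= d) ->
  `|ceval p x| <= K /\ `|ceval p x - ceval p y| <= K * d.
Proof.
move=> M0; elim/mpoly_ring_ind: p => [c|i|p q [K1 K10 h1] [K2 K20 h2]
    |p q [K1 K10 h1] [K2 K20 h2]].
- exists `|rc c| => // x y d _ _ d0 _.
  by rewrite /ceval !mmapC subrr normr0 mulr_ge0.
(* [M] bounds the value of a coordinate and [1] its Lipschitz constant. *)
- exists (M + 1) => [|x y d xM yM d0 xy]; first exact: addr_ge0.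
  rewrite /ceval !mmapX !mmap1U; split.
    by rewrite (le_trans (xM i)) // lerDl.
  by rewrite (le_trans (xy i)) // ler_peMl // lerDr.
- exists (K1 + K2) => [|x y d xM yM d0 xy]; first exact: addr_ge0.
  have [a1 b1] := h1 x y d xM yM d0 xy; have [a2 b2] := h2 x y d xM yM d0 xy.
  rewrite /ceval !mmapD; split.
    by rewrite (le_trans (ler_normD _ _)) // lerD.
  rewrite opprD addrACA mulrDl.
  by rewrite (le_trans (ler_normD _ _)) // lerD.
- exists (K1 * K2 + K1 * K2) => [|x y d xM yM d0 xy].
    by rewrite addr_ge0 // mulr_ge0.
  have [a1 b1] := h1 x y d xM yM d0 xy; have [a2 b2] := h2 x y d xM yM d0 xy.
  have yx i : `|y i - x i| <= d by rewrite distrC.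
  have [a3 _] := h2 y x d yM xM d0 yx.
  rewrite /ceval !rmorphM /= -/(ceval p x) -/(ceval q x) -/(ceval p y) -/(ceval q y).
  split.
    by rewrite normrM (le_trans (ler_pM _ _ a1 a2)) // lerDl mulr_ge0.
  have -> : ceval p x * ceval q x - ceval p y * ceval q y =
     ceval p x * (ceval q x - ceval q y) + (ceval p x - ceval p y) * ceval q y by ring.
  rewrite (le_trans (ler_normD _ _)) // !normrM mulrDl lerD //.
    by rewrite -mulrA ler_pM.
  by rewrite mulrAC ler_pM.
Qed.
End ComplexEvaluation.

(* A root-free disk of radius [delta] around [z0] keeps every factor
   [(z0 - r) / r] of [Q.[z0] / Q.[0]] away from zero. *)
Lemma horner_lower_bound (C : numClosedFieldType) (d : nat) (Q : {poly C})
    (z0 delta : C) :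
  (size Q <= d.+1)%N -> 0 < delta -> (forall r, root Q r -> delta <= `|z0 - r|) ->
  `|Q.[0]| * (delta / (delta + `|z0|)) ^+ d <= `|Q.[z0]|.
Proof.
move=> sQ d0 far.
have [->|Q0] := eqVneq Q 0; first by rewrite !horner0 normr0 mul0r.
have [rs Qrs] := closed_field_poly_normal Q.
have lcQ : lead_coef Q != 0 by rewrite lead_coef_eq0.
set k := delta / _; have dz : 0 < delta + `|z0| by rewrite ltr_wpDr.
have k0 : 0 <= k by rewrite divr_ge0 // ltW.
have k1 : k <= 1 by rewrite ler_pdivrMr // mul1r lerDl.
have srs : (size rs <= d)%N.
  by move: sQ; rewrite Qrs size_scale // size_prod_XsubC ltnS.
have far' r : r \in rs -> k * `|r| <= `|z0 - r|.
  move=> rrs; have {}far : delta <= `|z0 - r|.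
    by apply: far; rewrite Qrs rootZ // root_prod_XsubC.
  (* First [|r| <= |z0 - r| + |z0|], then [delta <= |z0 - r|] is used on the second summand. *)
  rewrite /k mulrAC ler_pdivrMr // (@le_trans _ _ (delta * (`|z0 - r| + `|z0|))) //.
    rewrite ler_wpM2l ?(ltW d0) //.
    by have := ler_normB z0 (z0 - r); rewrite subKr addrC.
  rewrite mulrDr mulrDr lerD //; first by rewrite mulrC.
  by rewrite ler_wpM2r.
rewrite Qrs !hornerZ !normrM -mulrA ler_wpM2l // !horner_prod !normr_prod.
apply: (@le_trans _ _ (\prod_(r <- rs) `|('X - r%:P).[0]| * k ^+ size rs)).
  by rewrite ler_wpM2l ?prodr_ge0 // ler_wiXn2l.
clearbody k; elim: rs far' {Qrs srs} => [|r rs IH] far'; first by rewrite !big_nil expr0 mulr1.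
rewrite !big_cons exprS mulrACA ler_pM ?mulr_ge0 ?prodr_ge0 ?exprn_ge0 //.
  by rewrite !hornerE normrN mulrC far' // mem_head.
by apply: IH => r' r'in; rewrite far' // in_cons r'in orbT.
Qed.

(** The [c] are the [- r^-1] for the roots [r], which are nonzero since [g.[0] != 0]. In this form
    the location of the roots becomes a bound on the [c], and their sum is the logarithmic
    derivative at [0]. *)
Lemma real_rooted_factor (R : realType) (g : {poly R}) :
  g.[0] != 0 ->
  (forall z : R[i], root (map_poly (real_complex R) g) z -> z \is Num.real) ->
  exists2 cs : seq R, (size cs < size g)%N &
    g = g.[0] *: \prod_(c <- cs) (1 + c *: 'X).
Proof.
move=> g0 rg; have gn0 : g != 0 by apply: contraNneq g0 => ->; rewrite horner0.
have [zs gzs] := closed_field_poly_normal (map_poly (real_complex R) g).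
have ln0 : lead_coef g != 0 by rewrite lead_coef_eq0.
have lcE : lead_coef (map_poly (real_complex R) g) = (real_complex R) (lead_coef g).
  by rewrite lead_coef_map.
have gE : g = lead_coef g *: \prod_(r <- map (@complex.Re R) zs) ('X - r%:P).
  apply: (map_poly_inj (real_complex R)).
  rewrite gzs lcE map_polyZ rmorph_prod big_map; congr (_ *: _).
  rewrite big_seq [RHS]big_seq; apply: eq_bigr => z zin.
  rewrite rmorphB /= map_polyX map_polyC /=; congr (_ - _%:P).
  apply/esym/RRe_real/rg; rewrite gzs rootZ ?root_prod_XsubC //.
  by rewrite lcE fmorph_eq0.
set rs := map _ _ in gE.
have r0 r : r \in rs -> r != 0.
  move=> rin; apply: contraNneq g0 => r0; rewrite -/(root g 0) gE rootZ //.
  by rewrite root_prod_XsubC -r0.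
exists (map (fun r => - r^-1) rs).
  by rewrite size_map [in X in (_ < X)%N]gE size_scale // size_prod_XsubC.
have -> : \prod_(c <- [seq - r^-1 | r <- rs]) (1 + c *: 'X) =
          (\prod_(r <- rs) (- r^-1)) *: \prod_(r <- rs) ('X - r%:P) :> {poly R}.
  rewrite big_map -scaler_prod big_seq [RHS]big_seq; apply: eq_bigr => r rin.
  by rewrite scalerBr !scaleNr opprK -mul_polyC -mul_polyC -polyCM mulVf ?r0 // addrC.
rewrite {1}gE scalerA; congr (_ *: _).
rewrite {2}gE hornerZ horner_prod -mulrA -big_split /= big_seq big1 ?mulr1 // => r rin.
by rewrite !hornerE mulrNN mulfV // r0.
Qed.

(** * Homotopies of polynomials without roots in a disk *)

(** The hypotheses make [P] relatively open and relatively closed in the connected set [[0, 1]]. *)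
Lemma unit_segment_clopen_ind (R : realType) (P : R -> Prop) :
  P 0 ->
  (forall s, 0 <= s <= 1 -> P s ->
     \forall s' \near s, 0 <= s' <= 1 -> P s') ->
  (forall s, 0 <= s <= 1 -> ~ P s ->
     \forall s' \near s, 0 <= s' <= 1 -> ~ P s') ->
  P 1.
Proof.
move=> P0 Po Pc.
have inE' (s : R) : `[0, 1]%classic s = (0 <= s <= 1).
  by rewrite /= in_itv.
suff: `[0, 1]%classic `&` P = `[0, 1]%classic.
  move=> E; have : (`[0, 1]%classic `&` P) 1 by rewrite E inE' ler01 lexx.
  by case.
apply: segment_connected.
- by exists 0; split => //; rewrite inE' lexx ler01.
- exists (interior [set s | 0 <= s <= 1 -> P s]); first exact: open_interior.
  apply/seteqP; split => s [sI Ps]; split => //.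
    by apply: Po => //; rewrite -inE'.
  by have := nbhs_singleton Ps; apply; rewrite -inE'.
- exists (~` interior [set s | 0 <= s <= 1 -> ~ P s]).
    exact/open_closedC/open_interior.
  apply/seteqP; split => s [sI Ps]; split => //.
    by move=> /nbhs_singleton; apply => //; rewrite -inE'.
  by apply: contrapT => nP; apply: Ps; apply: Pc => //; rewrite -inE'.
Qed.

Section Homotopy.
Context {R : realType}.
Local Notation rc := (real_complex R).

Lemma rc_Re_norm (z : R[i]) : rc (complex.Re `|z|) = `|z|.
Proof. exact/RRe_real/normr_real. Qed.

(** A point [r] outside the disk is at distance [|r - c| - rho] from it; the minimum over the list
    is positive. *)
Lemma disk_separation (rs : seq R[i]) (c : R[i]) (rho : R) :
  (forall r, r \in rs -> ~~ (`|r - c| <= rc rho)) ->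
  exists2 delta : R, 0 < delta &
    forall r z, r \in rs -> `|z - c| <= rc rho -> rc delta <= `|z - r|.
Proof.
elim: rs => [|r rs IH] out; first by exists 1.
have [d d0 dP] : exists2 delta : R, 0 < delta & forall r z, r \in rs ->
    `|z - c| <= rc rho -> rc delta <= `|z - r|.
  by apply: IH => r' r'in; apply: out; rewrite in_cons r'in orbT.
have := out r (mem_head _ _); rewrite -rc_Re_norm lecR -ltNge => rout.
exists (Num.min d (complex.Re `|r - c| - rho)).
  by rewrite lt_min d0 subr_gt0.
move=> r' z; rewrite in_cons => /orP[/eqP ->|r'in] zin; last first.
  by apply: le_trans (dP _ _ r'in zin); rewrite lecR ge_min lexx.
apply: (@le_trans _ _ (rc (complex.Re `|r - c| - rho))).
  by rewrite lecR ge_min lexx orbT.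
rewrite rmorphB /= rc_Re_norm lerBlDr.
have := ler_distD z r c; rewrite (distrC r z) => /le_trans; apply.
by rewrite lerD2l.
Qed.

Lemma near_lt_scale (s K eta : R) : 0 <= K -> 0 < eta ->
  \forall s' \near s, K * `|s - s'| < eta.
Proof.
move=> K0 e0; apply/nbhs_ballP; exists (eta / (K + 1)) => /=.
  by rewrite divr_gt0 // ltr_wpDl.
move=> s'; rewrite /ball /= ltr_pdivlMr ?ltr_wpDl // => h.
apply: le_lt_trans h; rewrite mulrC ler_wpM2l // lerDl //.
Qed.

(** Roots can enter the disk only through its boundary circle. The common degree bound and the
    common value [k] at [0] make [horner_lower_bound] uniform in [s], which gives both halves of the
    clopen argument. *)
Lemma disk_homotopy (f : R -> {poly R[i]}) (d : nat) (k c : R[i]) (rho K : R) :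
  (forall s, (size (f s) <= d.+1)%N) -> k != 0 -> (forall s, (f s).[0] = k) ->
  0 <= rho -> 0 <= K ->
  (forall s s' z, 0 <= s <= 1 -> 0 <= s' <= 1 -> `|z - c| <= rc rho ->
     `|(f s).[z] - (f s').[z]| <= rc (K * `|s - s'|)) ->
  (forall s z, 0 <= s <= 1 -> `|z - c| = rc rho -> ~~ root (f s) z) ->
  (forall z, `|z - c| <= rc rho -> ~~ root (f 0) z) ->
  forall z, `|z - c| <= rc rho -> ~~ root (f 1) z.
Proof.
move=> sf k0 fk rho0 K0 flip fb f0.
pose M := `|c| + rc rho; have M0 : 0 <= M by rewrite addr_ge0 // ler0c.
have zM z : `|z - c| <= rc rho -> `|z| <= M.
  move=> zin; rewrite /M -lerBlDl; apply: le_trans zin; exact: lerB_dist.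
have fn0 s : f s != 0 by apply: contraNneq k0 => f0'; rewrite -(fk s) f0' horner0.
have lower s z (delta : R) : `|z - c| <= rc rho -> 0 < delta ->
    (forall r, root (f s) r -> rc delta <= `|z - r|) ->
    `|k| * (rc delta / (rc delta + M)) ^+ d <= `|(f s).[z]|.
  move=> zin d0 far; have d0' : 0 < rc delta by rewrite (ltcR 0).
  have := horner_lower_bound (sf s) d0' far; rewrite fk; apply: le_trans.
  have dM : 0 < rc delta + M by rewrite ltr_wpDr.
  have dz : 0 < rc delta + `|z| by rewrite ltr_wpDr.
  rewrite ler_wpM2l // lerXn2r ?nnegrE ?divr_ge0 ?(ltW d0') ?(ltW dM) ?(ltW dz) //.
  rewrite ler_pM2l // lef_pV2 ?posrE //.
  by rewrite lerD2l zM.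
have pos (delta : R) : 0 < delta -> exists2 eta : R, 0 < eta &
    rc eta = `|k| * (rc delta / (rc delta + M)) ^+ d.
  move=> d0; have d0' : 0 < rc delta by rewrite (ltcR 0).
  have v0 : 0 < `|k| * (rc delta / (rc delta + M)) ^+ d.
    have dM : 0 < rc delta + M by rewrite ltr_wpDr.
    by rewrite mulr_gt0 ?normr_gt0 // exprn_gt0 // divr_gt0.
  exists (complex.Re (`|k| * (rc delta / (rc delta + M)) ^+ d)).
    by rewrite -ltcR RRe_real // gtr0_real.
  by rewrite RRe_real // gtr0_real.
apply: (@unit_segment_clopen_ind R
  (fun s => forall z, `|z - c| <= rc rho -> ~~ root (f s) z)) => // s sI.
(* Openness: the roots of [f s] keep a distance from the disk, so [f s] is bounded below there by
   some [eta], and a change smaller than [eta] creates no root. *)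
- move=> good.
  have [rs rsE] := closed_field_poly_normal (f s).
  have rsP r : root (f s) r = (r \in rs).
    by rewrite rsE rootZ ?lead_coef_eq0 // root_prod_XsubC.
  have [r|delta d0 dP] := @disk_separation rs c rho.
    by rewrite -rsP; apply: contraL; apply: good.
  have [eta e0 eE] := pos _ d0.
  have := near_lt_scale s K0 e0; apply: filterS => s' near_s s'I z zin.
  apply/negP => /rootP fz.
  have := flip s s' z sI s'I zin; rewrite fz subr0 => up.
  have low := lower s z delta zin d0 (fun r fr => dP r z (eq_ind _ is_true fr _ (rsP r)) zin).
  have := le_trans low up; rewrite -eE lecR leNgt near_s //.
(* Closedness: a root [z] of [f s] lies strictly inside the disk. If [f s'] were root-free in the
   disk, its roots would be at distance at least [rho - |z - c|] from [z], so its value at [z] could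
   not be small. *)
- move=> /existsNP[z /not_implyP[zin /negP]]; rewrite negbK => fz.
  have zlt : complex.Re `|z - c| < rho.
    rewrite lt_neqAle -lecR rc_Re_norm zin andbT.
    apply/eqP => E; have := fb s z sI; rewrite fz -rc_Re_norm E => /(_ erefl).
    by [].
  have d0 : 0 < rho - complex.Re `|z - c| by rewrite subr_gt0.
  have [eta e0 eE] := pos _ d0.
  have := near_lt_scale s K0 e0; apply: filterS => s' near_s s'I good.
  have := flip s s' z sI s'I zin; rewrite (rootP fz) sub0r normrN => up.
  have low := lower s' z _ zin d0 _.
  suff /low {}low : forall r, root (f s') r ->
      rc (rho - complex.Re `|z - c|) <= `|z - r|.
    by have := le_trans low up; rewrite -eE lecR leNgt near_s.
  move=> r fr; have := good r; rewrite fr => /contraTN/(_ isT).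
  rewrite -rc_Re_norm lecR -ltNge -(rc_Re_norm (z - r)) lecR => rout.
  have := ler_distD z r c; rewrite (distrC r z).
  rewrite -(rc_Re_norm (r - c)) -(rc_Re_norm (z - r)) -(rc_Re_norm (z - c)).
  rewrite -rmorphD lecR => tri.
  by rewrite lerBlDr (le_trans (ltW rout)).
Qed.

End Homotopy.

(** * Change of base point of a real zero polynomial *)

Section Garding.
Context {R : realType} {n : nat}.
Implicit Types (p : mpoly n R) (e a v w : 'rV[R]_n).
Local Notation rc := (real_complex R).
Local Notation Re := complex.Re.
Local Notation Im := complex.Im.

Lemma finite_norm_bound (x : 'I_n -> R[i]) :
  exists2 B : R[i], 0 <= B & forall i, `|x i| <= B.
Proof.
exists (\sum_i `|x i|) => [|i]; first exact: sumr_ge0.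
by rewrite (bigD1 i) //= lerDl sumr_ge0.
Qed.

Lemma cline_lipschitz p (a : 'I_n -> R[i]) (M : R[i]) : 0 <= M ->
  exists2 K : R, 0 <= K & forall u u' z (d : R[i]),
    `|z| <= M -> (forall i, `|u i| <= M) -> (forall i, `|u' i| <= M) ->
    0 <= d -> (forall i, `|u i - u' i| <= d) ->
    `|(cline p a u).[z] - (cline p a u').[z]| <= rc K * d.
Proof.
move=> M0; have [B B0 aB] := finite_norm_bound a.
(* [B + M * M] bounds the coordinates of [a + z u]; moving [u] by [d] moves them by at most
   [M * d]. *)
have [K K0 KP] := ceval_lipschitz p (addr_ge0 B0 (mulr_ge0 M0 M0)).
have KM0 : 0 <= K * M by rewrite mulr_ge0.
exists (Re (K * M)) => [|u u' z d zM uM u'M d0 ud].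
  by rewrite -ler0c RRe_real // ger0_real.
rewrite !horner_cline RRe_real ?ger0_real // -mulrA.
apply: (KP _ _ (M * d) _ _ _ _).2 => [i|i||i].
- by rewrite (le_trans (ler_normD _ _)) // lerD // normrM ler_pM.
- by rewrite (le_trans (ler_normD _ _)) // lerD // normrM ler_pM.
- by rewrite mulr_ge0.
- by rewrite opprD addrACA subrr add0r -mulrBr normrM ler_pM.
Qed.

Lemma Re_norm_sqr (z : R[i]) : Re `|z| ^+ 2 = Re z ^+ 2 + Im z ^+ 2.
Proof. by rewrite normc_def /= sqr_sqrtr // addr_ge0 // sqr_ge0. Qed.

Lemma norm_rc (s : R) : `|rc s| = rc `|s|.
Proof. by rewrite normc_def /= expr0n addr0 sqrtr_sqr. Qed.

Lemma Im_le_norm (z : R[i]) : `|Im z| <= Re `|z|.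
Proof.
rewrite -ler_sqr ?nnegrE //; last by rewrite -ler0c rc_Re_norm.
by rewrite Re_norm_sqr real_normK ?num_real // lerDr sqr_ge0.
Qed.

(* The disk is the image of the closed half-plane [Im t >= al] under [t |-> 1 / t]. *)
Lemma inversion_diskE (al : R) (z : R[i]) : 0 < al ->
  let c := Complex 0 (- (2 * al)^-1) in
  (`|z - c| <= rc (2 * al)^-1) = (al * (Re z ^+ 2 + Im z ^+ 2) <= - Im z) /\
  (`|z - c| = rc (2 * al)^-1 -> al * (Re z ^+ 2 + Im z ^+ 2) = - Im z).
Proof.
move=> al0 c; have b0 : 0 < (2 * al)^-1 by rewrite invr_gt0 mulr_gt0.
have nE : Re `|z - c| ^+ 2 - (2 * al)^-1 ^+ 2 =
    al^-1 * (al * (Re z ^+ 2 + Im z ^+ 2) + Im z).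
  rewrite Re_norm_sqr /c; case: z => x y /=; field; exact: lt0r_neq0.
split.
  rewrite -rc_Re_norm lecR -ler_sqr ?nnegrE ?(ltW b0) //; last first.
    by rewrite -ler0c rc_Re_norm.
  by rewrite -subr_le0 nE pmulr_rle0 ?invr_gt0 // -[in RHS]subr_le0 opprK.
move=> E; move: nE; rewrite E /= subrr => /esym/eqP.
by rewrite mulf_eq0 invr_eq0 gt_eqF //= addr_eq0 => /eqP.
Qed.

Lemma real_zero_ceval p e w (z : R[i]) : real_zero_poly e p ->
  ceval p (fun i => rc (e 0 i) + z * rc (w 0 i)) = 0 -> z \is Num.real.
Proof.
move=> [pe rz]; have [->|w0] := eqVneq w 0.
  under [X in ceval _ X]eq_fun do rewrite mxE rmorph0 mulr0 addr0.
  by rewrite ceval_real => /eqP; rewrite fmorph_eq0 gt_eqF.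
by move=> h; apply: (rz w w0); rewrite map_line_poly rootE horner_cline h.
Qed.

(* On the boundary circle [1 / z - 'i * al] is real, so the evaluation point is
   [e] plus the nonreal [z] times a real vector; at [v = 0] the roots are known. *)
Lemma no_root_in_inversion_disk p e a v (al : R) :
  real_zero_poly e p ->
  (forall t, 0 <= t <= 1 -> 0 < peval p (e + t *: (a - e))) -> 0 < al ->
  forall z : R[i], al * (Re z ^+ 2 + Im z ^+ 2) <= - Im z ->
  ~~ root (cline p (fun i => rc (a 0 i))
     (fun i => rc (v 0 i) - 'i%C * rc (al * (a - e) 0 i))) z.
Proof.
move=> rz pos al0 z.
have [diskE _] := inversion_diskE z al0; rewrite -diskE {diskE}.
set w := a - e; set c := Complex _ _; set rho := _^-1.
pose u (s : R) (i : 'I_n) := rc (s * v 0 i) - 'i%C * rc (al * w 0 i).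
pose f s := cline p (fun i => rc (a 0 i)) (u s).
have -> : (fun i => rc (v 0 i) - 'i%C * rc (al * w 0 i)) = u 1.
  by apply/funext => i; rewrite /u mul1r.
have pa : 0 < peval p a.
  by have := pos 1; rewrite scale1r subrKC; apply; rewrite ler01 lexx.
have rho0 : 0 <= rho by rewrite invr_ge0 mulr_ge0 // ltW.
have [d sf] := size_cline p.
have [V V0 vV] := finite_norm_bound (fun i => rc (v 0 i)).
have [W W0 wW] := finite_norm_bound (fun i => 'i%C * rc (al * w 0 i)).
have rhoC : 0 <= rc rho by rewrite ler0c.
pose M := `|c| + rc rho + (V + W).
have M0 : 0 <= M by rewrite !addr_ge0.
have [K K0 KP] := cline_lipschitz p (fun i => rc (a 0 i)) M0.
have uM s i : 0 <= s <= 1 -> `|u s i| <= M.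
  move=> /andP[s0 s1]; apply: (@le_trans _ _ (V + W)); last by rewrite lerDr addr_ge0.
  rewrite (le_trans (ler_normB _ _)) // lerD // rmorphM normrM.
  rewrite -[V]mul1r; apply: ler_pM => //; last exact: vV.
  by rewrite norm_rc ger0_norm // -(rmorph1 (real_complex R)) lecR.
apply: (@disk_homotopy R f d (rc (peval p a)) c rho (K * Re V)) => //.
- by move=> s; apply: sf.
- by rewrite fmorph_eq0 gt_eqF.
- move=> s; rewrite horner_cline -ceval_real; congr ceval; apply/funext => i.
  by rewrite mul0r addr0.
- by rewrite mulr_ge0 // -ler0c RRe_real ?ger0_real.
- move=> s s' z1 sI s'I zin.
  have -> : rc (K * Re V * `|s - s'|) = rc K * (V * rc `|s - s'|).
    by rewrite !rmorphM /= RRe_real ?ger0_real // mulrA.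
  apply: KP => // [|i|i||i].
  - rewrite (@le_trans _ _ (`|c| + rc rho)) // ?lerDl ?addr_ge0 // -lerBlDl.
    by apply: le_trans zin; apply: lerB_dist.
  - exact: uM.
  - exact: uM.
  - by rewrite mulr_ge0 // ler0c.
  - have -> : u s i - u s' i = rc (v 0 i) * rc (s - s').
      by rewrite /u !rmorphB !rmorphM /=; ring.
    rewrite normrM (norm_rc (s - s')); apply: ler_wpM2r; last exact: vV.
    by rewrite ler0c.
- move=> s z1 sI z1b; apply/negP; rewrite rootE horner_cline => /eqP pz.
  have [_ /(_ z1b)] := inversion_diskE z1 al0; case: z1 pz {z1b} => x y /= pz bd.
  have [y0|y0] := eqVneq y 0.
    have x0 : x = 0.
      apply/eqP; rewrite -sqrf_eq0; move/eqP: bd.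
      by rewrite y0 oppr0 expr0n addr0 mulf_eq0 gt_eqF.
    have := ceval_real p a; rewrite (_ : ceval _ _ = 0); last first.
      by rewrite -pz x0 y0; congr ceval; apply/funext => i; rewrite mul0r addr0.
    by move=> [/esym/eqP]; rewrite gt_eqF.
  suff : Complex x y \is Num.real by rewrite complex_real (negPf y0).
  (* The point is [e + z ((1/z - i al) (a - e) + s v)], and the circle equation gives [1/z - i al =
     x / (x^2 + y^2) = - al x / y]. *)
  apply: (real_zero_ceval (e := e) (w := (- (al * x / y)) *: w + s *: v) rz).
  rewrite -pz; congr ceval; apply/funext => i.
  have E1 : x * (al * x / y) + y * al + 1 = 0.
    have -> : x * (al * x / y) + y * al + 1 = (al * (x ^+ 2 + y ^+ 2) + y) / y by field.
    by rewrite bd addNr mul0r.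
  have E2 : - y * (al * x / y) + x * al = 0 by field.
  rewrite /u /w !mxE; move: (a 0 i) (v 0 i) (e 0 i) => ai vi ei.
  simpc; apply/eqP; rewrite eq_complex /= -subr_eq0 -[X in _ && X]subr_eq0.
  apply/andP; split; apply/eqP.
    transitivity ((ei - ai) * (x * (al * x / y) + y * al + 1)); first by ring.
    by rewrite E1 mulr0.
  transitivity ((ai - ei) * (- y * (al * x / y) + x * al)); first by ring.
  by rewrite E2 mulr0.
(* At [s = 0] the point is [e + (1 - i al z) (a - e)]. A zero forces the factor to be real, so
   [x = 0]; the disk condition then puts [1 + al y] in [[0, 1]], where [p] is positive. *)
- move=> [x y] zin; apply/negP; rewrite rootE horner_cline => /eqP pz.
  have [diskE _] := inversion_diskE (Complex x y) al0.
  move: zin; rewrite diskE {diskE} /= => zin.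
  have y0 : y <= 0.
    by rewrite -oppr_ge0 (le_trans _ zin) // mulr_ge0 ?addr_ge0 ?sqr_ge0 // ltW.
  have eE : (fun i => rc (a 0 i) + Complex x y * u 0 i) =
            (fun i => rc (e 0 i) + (1 - 'i%C * rc al * Complex x y) * rc (w 0 i)).
    apply/funext => i; have -> : a 0 i = e 0 i + w 0 i by rewrite !mxE subrKC.
    by rewrite /u mul0r rmorphM rmorphD /= rmorph0; ring.
  have := real_zero_ceval rz; rewrite eE in pz => /(_ _ _ pz).
  simpc; rewrite complex_real oppr_eq0 mulf_eq0 gt_eqF //= => /eqP x0.
  have tI : 0 <= 1 + al * y <= 1.
    rewrite gerDl pmulr_rle0 // y0 andbT.
    move: zin; rewrite x0 expr0n add0r => zin.
    have [->|yn0] := eqVneq y 0; first by rewrite mulr0 addr0.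
    have ny : 0 < - y by rewrite oppr_gt0 lt_neqAle yn0.
    by rewrite -(pmulr_rge0 _ ny) mulrDr mulr1 addrC -subr_ge0 in zin *; nra.
  have := ceval_real p (e + (1 + al * y) *: w); rewrite (_ : ceval _ _ = 0); last first.
    rewrite -pz; congr ceval; apply/funext => i.
    rewrite !mxE x0; simpc; apply/eqP; rewrite eq_complex /=.
    by apply/andP; split; apply/eqP; ring.
  by move=> [/esym/eqP]; rewrite gt_eqF // pos.
Qed.
Lemma small_scale (X Y A B : R) : 0 <= X -> 0 <= Y -> 0 < A -> 0 < B ->
  exists2 al, 0 < al <= 1 & al * X <= A /\ al * Y < B.
Proof.
move=> X0 Y0 A0 B0; pose C := Num.min A B.
have C0 : 0 < C by rewrite lt_min A0 B0.
have D0 : 0 < C + (X + Y) by rewrite ltr_wpDr // addr_ge0.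
exists (C / (C + (X + Y))).
  by rewrite divr_gt0 //= ler_pdivrMr // mul1r lerDl addr_ge0.
split.
  rewrite mulrAC ler_pdivrMr // ler_pM ?(ltW C0) //; first by rewrite ge_min lexx.
  by have := ltW C0; lra.
rewrite mulrAC ltr_pdivrMr //; apply: (@le_lt_trans _ _ (B * Y)).
  by rewrite ler_wpM2r // ge_min lexx orbT.
by rewrite ltr_pM2l //; lra.
Qed.

(** The root-free disks of [no_root_in_inversion_disk] exhaust the lower half-plane as [al] tends to
    [0]. Hence for small [al] the polynomial [f al] is bounded below at [tau], whereas it would tend
    to [0] there if [tau] were a zero of the limit. *)
Lemma ceval_neq0_lower p e a v (tau : R[i]) :
  real_zero_poly e p ->
  (forall t, 0 <= t <= 1 -> 0 < peval p (e + t *: (a - e))) ->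
  Im tau < 0 -> ceval p (fun i => rc (a 0 i) + tau * rc (v 0 i)) != 0.
Proof.
move=> rz pos tau0; apply/negP => /eqP ptau.
pose u (al : R) i := rc (v 0 i) - 'i%C * rc (al * (a - e) 0 i).
pose f al := cline p (fun i => rc (a 0 i)) (u al).
have pa : 0 < peval p a.
  by have := pos 1; rewrite scale1r subrKC; apply; rewrite ler01 lexx.
have fk al : (f al).[0] = rc (peval p a).
  rewrite horner_cline -ceval_real; congr ceval; apply/funext => i.
  by rewrite mul0r addr0.
have f0 : (f 0).[tau] = 0.
  rewrite horner_cline -ptau; congr ceval; apply/funext => i.
  by rewrite /u mul0r rmorph0 mulr0 subr0.
have [d sf] := size_cline p.
have [V V0 vV] := finite_norm_bound (fun i => rc (v 0 i)).
have [W W0 wW] := finite_norm_bound (fun i => 'i%C * rc ((a - e) 0 i)).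
pose M := `|tau| + (V + W).
have M0 : 0 <= M by rewrite !addr_ge0.
have [K K0 KP] := cline_lipschitz p (fun i => rc (a 0 i)) M0.
have uE al i : u al i = rc (v 0 i) - rc al * ('i%C * rc ((a - e) 0 i)).
  by rewrite /u rmorphM mulrCA.
have uM al i : 0 <= al <= 1 -> `|u al i| <= M.
  move=> /andP[al0 al1]; apply: (@le_trans _ _ (V + W)); last by rewrite lerDr.
  rewrite uE (le_trans (ler_normB _ _)) // lerD //.
  rewrite normrM -[W]mul1r; apply: ler_pM => //.
  by rewrite norm_rc ger0_norm // -(rmorph1 (real_complex R)) lecR.
pose delta := - Im tau / 2; have d0 : 0 < delta by rewrite divr_gt0 // oppr_gt0.
have d0' : 0 < rc delta by rewrite (ltcR 0).
pose N := Re `|tau| + delta.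
have ReN (z : R[i]) : 0 <= Re `|z| by rewrite -ler0c rc_Re_norm.
have N0 : 0 <= N by rewrite addr_ge0 // ltW.
pose eta := `|rc (peval p a)| * (rc delta / (rc delta + `|tau|)) ^+ d.
have e0 : 0 < eta.
  have dt : 0 < rc delta + `|tau| by rewrite ltr_wpDr.
  by rewrite mulr_gt0 ?normr_gt0 ?fmorph_eq0 ?gt_eqF // exprn_gt0 // divr_gt0.
have e0' : 0 < Re eta by rewrite -(ltcR 0) RRe_real // gtr0_real.
have ReW : 0 <= Re W by rewrite -ler0c RRe_real // ger0_real.
(* The first bound puts every point within [delta] of [tau] into the root-free disk; the second
   keeps [|f al|] at [tau] below its lower bound [eta]. *)
have [al /andP[al0 al1] [alN alK]] :=
  small_scale (sqr_ge0 N) (mulr_ge0 K0 ReW) d0 e0'.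
have far r : root (f al) r -> rc delta <= `|tau - r|.
  move=> fr; rewrite -(rc_Re_norm (tau - r)) lecR leNgt; apply/negP => near_tau.
  have out : - Im r < al * Re `|r| ^+ 2.
    rewrite Re_norm_sqr ltNge; apply: contraL fr.
    exact: no_root_in_inversion_disk.
  have rN : Re `|r| <= N.
    have := ler_normB tau (tau - r); rewrite subKr.
    rewrite -(rc_Re_norm r) -(rc_Re_norm tau) -(rc_Re_norm (tau - r)) -rmorphD lecR.
    by move/le_trans; apply; rewrite lerD2l ltW.
  have ir : delta < - Im r.
    have := le_lt_trans (Im_le_norm (tau - r)) near_tau.
    rewrite raddfB /= ltr_norml => /andP[+ _].
    move: (Im tau) (Im r) @delta {d0 d0' N N0 eta e0 e0' alN alK near_tau rN} => x y /=.
    by clear; lra.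
  have : al * Re `|r| ^+ 2 <= delta.
    by apply: le_trans alN; rewrite ler_wpM2l ?(ltW al0) // lerXn2r // nnegrE.
  by rewrite leNgt (lt_trans ir out).
have := horner_lower_bound (sf _ _) d0' far; rewrite fk -/eta.
apply/negP; rewrite -real_ltNge ?normr_real ?gtr0_real //.
have := KP (u al) (u 0) tau (rc al * W).
rewrite -/(f al) -/(f 0) f0 subr0 => H; apply: (le_lt_trans (H _ _ _ _ _)).
- by rewrite lerDl addr_ge0.
- by move=> i; apply: uM; rewrite ltW.
- by move=> i; apply: uM; rewrite lexx ler01.
- by rewrite mulr_ge0 // ler0c ltW.
- move=> i; rewrite !uE rmorph0 mul0r subr0 addrC addKr normrN normrM norm_rc.
  rewrite (gtr0_norm al0); apply: ler_wpM2l; last exact: wW.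
  by rewrite ler0c ltW.
rewrite -(RRe_real (gtr0_real e0)) -(RRe_real (ger0_real W0)) -!rmorphM ltcR.
by rewrite mulrCA.
Qed.

(** Zeros in the upper half-plane reduce to the lower one by passing from [(z, v)] to [(- z, - v)],
    which fixes the evaluation point. *)
Lemma real_zero_poly_base_change p e a :
  real_zero_poly e p ->
  (forall t, 0 <= t <= 1 -> 0 < peval p (e + t *: (a - e))) ->
  real_zero_poly a p.
Proof.
move=> rz pos; split.
  by have := pos 1; rewrite scale1r subrKC; apply; rewrite ler01 lexx.
move=> v _ z; rewrite map_line_poly rootE horner_cline => pz.
have [z0|z0|z0] := ltgtP (Im z) 0.
- by have := ceval_neq0_lower v rz pos z0; rewrite pz.
- have nz0 : Im (- z) < 0 by rewrite raddfN /= oppr_lt0.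
  have := ceval_neq0_lower (- v) rz pos nz0.
  under [X in ceval _ X]eq_fun do rewrite mxE rmorphN mulrNN.
  by rewrite pz.
- by case: z z0 {pz} => x y /= ->; rewrite complex_real.
Qed.

End Garding.

(** * The component of the base point *)

Lemma peval_continuous (R : realType) (n : nat) (p : mpoly n R) :
  continuous (peval p : 'rV[R]_n -> R).
Proof.
elim/mpoly_ring_ind: p => [c|i|p q cp cq|p q cp cq].
- have -> : peval (mpolyC n c) = cst c by apply/funext => x; rewrite /peval mevalC.
  exact: cst_continuous.
- have -> : peval (mpolyX R (mnm1 i)) = (fun x => x 0 i).
    by apply/funext => x; rewrite /peval mevalXU.
  exact: coord_continuous.
- have -> : peval (p + q) = peval p \+ peval q.
    by apply/funext => x; rewrite /peval mevalD.
  by move=> x; apply: continuousD; [exact: cp|exact: cq].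
- have -> : peval (p * q) = peval p \* peval q.
    by apply/funext => x; rewrite /peval mevalM.
  by move=> x; apply: continuousM; [exact: cp|exact: cq].
Qed.

Section Component.
Context {R : realType} {n : nat}.
Implicit Types (p : mpoly n R) (a e v w x y : 'rV[R]_n).
Local Notation rc := (real_complex R).

(** The star of [e] in [p > 0]; for a real zero polynomial it turns out to be the whole
    component. *)
Definition pos_segment p e : set 'rV[R]_n :=
  [set x | forall t, 0 <= t <= 1 -> 0 < peval p (e + t *: (x - e))].

Definition pos_component p e : set 'rV[R]_n :=
  connected_component [set x | 0 < peval p x] e.

Lemma segment_rV_connected e v :
  connected [set e + t *: v | t in `[0, 1]%classic : set R].
Proof.
apply: connected_continuous_connected; first exact: segment_connected.
apply: continuous_subspaceT => t; apply: cvgD; first exact: cvg_cst.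
exact: cvgZr_tmp.
Qed.

Lemma pos_segment_component p e : pos_segment p e `<=` pos_component p e.
Proof.
move=> x ex; pose B := [set e + t *: (x - e) | t in `[0, 1]%classic : set R].
suff: B `<=` pos_component p e.
  by apply; exists 1; rewrite /= ?in_itv /= ?ler01 ?lexx // scale1r subrKC.
apply: connected_component_max.
- by exists 0; rewrite /= ?in_itv /= ?ler01 ?lexx // scale0r addr0.
- by move=> _ [t tI <-]; apply: ex; move: tI; rewrite /= in_itv.
- exact: segment_rV_connected.
Qed.

Lemma segment_peval_continuous p e :
  continuous (fun z : R * 'rV[R]_n => peval p (e + z.1 *: (z.2 - e))).
Proof.
move=> z; apply: (@continuous_comp _ _ _ (fun z : R * 'rV[R]_n => e + z.1 *: (z.2 - e))).
  apply: cvgD; first exact: cvg_cst.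
  apply: cvgZ; first exact: cvg_fst.
  by apply: cvgB; [exact: cvg_snd|exact: cvg_cst].
exact: peval_continuous.
Qed.

(** This is the tube lemma over the compact segment [[0, 1]]. *)
Lemma pos_segment_open p e : open (pos_segment p e).
Proof.
rewrite openE => x ex.
have cont := @segment_peval_continuous p e.
have /compact_near_coveringP ncov := @segment_compact R 0 1.
have near01 : \forall x' \near x, `[0, 1]%classic `<=`
    [set t : R | 0 < peval p (e + t *: (x' - e))].
  apply: (ncov _ (nbhs x) (fun x' (t : R) => 0 < peval p (e + t *: (x' - e)))).
  move=> t; rewrite /= in_itv /= => tI.
  exact: (cvgr_gt (peval p (e + t *: (x - e))) (cont (t, x)) _ (ex t tI)).
apply: (filterS _ near01) => x' sub t tI; apply: sub.
by rewrite /= in_itv.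
Qed.

(** On the line from [e] to [x] the zeros of [p] are real with parameter outside [[0, 1]], so they
    are at distance at least [Num.min t (1 - t)] from [t]; [horner_lower_bound] then gives a bound
    independent of [x]. *)
Lemma pos_segment_lower_bound p e (t : R) :
  real_zero_poly e p -> 0 <= t < 1 ->
  exists2 eta : R, 0 < eta &
    forall x, pos_segment p e x -> eta <= peval p (e + t *: (x - e)).
Proof.
move=> rz /andP[t0 t1]; have [pe _] := rz.
have [t00|t00] := eqVneq t 0.
  by exists (peval p e) => // x _; rewrite t00 scale0r addr0.
have {}t0 : 0 < t by rewrite lt_neqAle eq_sym t00.
have [d sf] := size_cline p.
pose delta := Num.min t (1 - t).
have d0 : 0 < delta by rewrite lt_min t0 subr_gt0.
have d0' : 0 < rc delta by rewrite (ltcR 0).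
exists (peval p e * (delta / (delta + t)) ^+ d).
  by rewrite mulr_gt0 // exprn_gt0 // divr_gt0 // addr_gt0.
move=> x ex; pose Q := cline p (fun i => rc (e 0 i)) (fun i => rc ((x - e) 0 i)).
have QE s : Q.[rc s] = rc (peval p (e + s *: (x - e))).
  by rewrite /Q -map_line_poly horner_map horner_line_poly.
have far r : root Q r -> rc delta <= `|rc t - r|.
  move=> Qr; have /complex_realP[s rE] : r \is Num.real.
    by apply: (real_zero_ceval (w := x - e) rz); rewrite -horner_cline; apply/eqP.
  move: Qr; rewrite rE rootE QE fmorph_eq0 => /eqP ps.
  rewrite -rmorphB norm_rc lecR /delta.
  have : ~~ (0 <= s <= 1) by apply/negP => /ex; rewrite ps ltxx.
  rewrite negb_and -!ltNge => /orP[s0|s1].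
    by rewrite ge_min ger0_norm ?subr_ge0 ?(ltW (lt_trans s0 t0)) // lerBrDr gerDl (ltW s0).
  rewrite ge_min ltr0_norm ?subr_lt0 ?(lt_trans t1 s1) // opprB lerD2r (ltW s1) orbT //.
have := horner_lower_bound (sf _ _) d0' far; rewrite -/Q (QE t) (QE 0) scale0r addr0.
rewrite !norm_rc -rmorphD -fmorphV -rmorphM -rmorphXn.
rewrite -rmorphM lecR (gtr0_norm pe) (gtr0_norm t0) gtr0_norm //.
by apply: ex; rewrite (ltW t0) (ltW t1).
Qed.

(** The lower bound does not depend on the point of the star, so it survives the passage to the
    closure. *)
Lemma closure_pos_segment p e x (t : R) : real_zero_poly e p ->
  closure (pos_segment p e) x -> 0 <= t < 1 -> 0 < peval p (e + t *: (x - e)).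
Proof.
move=> rz clx tI; have [eta e0 lb] := pos_segment_lower_bound rz tI.
apply: (lt_le_trans e0); rewrite leNgt; apply/negP => small.
have : \forall x' \near x, peval p (e + t *: (x' - e)) < eta.
  have [[A B] /= [At Bx] AB] :=
    cvgr_lt _ (@segment_peval_continuous p e (t, x)) _ small.
  apply: filterS Bx => x' Bx'; apply: (AB (t, x')); split => //=.
  exact: nbhs_singleton.
by move=> /clx[x' [/lb]]; rewrite leNgt => /negP.
Qed.

End Component.

(** * Star shape of the component and linear factors along its segments *)

Section Faces.
Context {R : realType} {n : nat}.
Implicit Types (p : mpoly n R) (a e u v w x y : 'rV[R]_n).
Local Notation rc := (real_complex R).

(** The star is open, and relatively closed in the component: for a limit point, parameters [t < 1]
    come from [closure_pos_segment] and [t = 1] from positivity on the component. *)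
Lemma pos_componentE p e : real_zero_poly e p -> pos_component p e = pos_segment p e.
Proof.
move=> rz; have [pe _] := rz; apply/seteqP; split; last exact: pos_segment_component.
suff <- : pos_component p e `&` pos_segment p e = pos_component p e by move=> x [].
apply: (component_connected _).
- exists e; split; first exact: connected_component_refl.
  by move=> t _; rewrite subrr scaler0 addr0.
- by exists (pos_segment p e) => //; exact: pos_segment_open.
- exists (closure (pos_segment p e)); first exact: closed_closure.
  apply/seteqP; split => x [Cx]; first by move=> /subset_closure.
  move=> clx; split => // t /andP[t0 t1].
  have [->|tn1] := eqVneq t 1.
    by rewrite scale1r subrKC; exact: connected_component_sub Cx.
  by apply: (closure_pos_segment rz clx); rewrite t0 lt_neqAle tn1.
Qed.

(** Supplies interior points through which a boundary point is studied as [t] tends to [0]; on the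
    segments from [e] to them, the parameter towards [x] stays below [1]. *)
Lemma closure_component_segment p e x (t : R) : real_zero_poly e p ->
  closure (pos_component p e) x -> 0 < t <= 1 ->
  pos_component p e (x + t *: (e - x)).
Proof.
move=> rz clx /andP[t0 t1]; rewrite pos_componentE // => s /andP[s0 s1].
have -> : e + s *: (x + t *: (e - x) - e) = e + (s * (1 - t)) *: (x - e).
  by apply/rowP => i; rewrite !mxE; ring.
apply: closure_pos_segment => //; first by rewrite -pos_componentE.
have t1' : 0 <= 1 - t by rewrite subr_ge0.
rewrite mulr_ge0 //= (le_lt_trans (ler_wpM2r t1' s1)) // mul1r ltrBlDr ltrDl //.
Qed.

Lemma real_zero_component p e a : real_zero_poly e p ->
  pos_component p e a -> real_zero_poly a p.
Proof.
move=> rz; rewrite pos_componentE // => ea; exact: real_zero_poly_base_change rz ea.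
Qed.

Lemma deriv_line_poly p a u :
  (line_poly p a u)^`() = \sum_i u 0 i *: line_poly (mderiv i p) a u.
Proof.
elim/mpoly_ring_ind: p => [c|j|p q hp hq|p q hp hq].
- rewrite /line_poly mmapC derivC big1 // => i _.
  by rewrite mderivC mmap0 scaler0.
- rewrite {1}/line_poly mmapX mmap1U derivD derivC add0r derivM derivC mul0r add0r.
  rewrite derivX mulr1 (bigD1 j) //= big1 ?addr0 => [|i ij].
    rewrite mderivX /line_poly mnm1E eqxx scale1r.
    have -> : mnm_sub (mnm1 j) (mnm1 j) = mnm0 by apply/mnmP => i; rewrite mnmBE subnn mnm0E.
    by rewrite mmapX mmap11 alg_polyC.
  by rewrite mderivX mnm1E eq_sym (negPf ij) scale0r /line_poly mmap0 scaler0.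
- rewrite /line_poly mmapD derivD -/(line_poly p a u) -/(line_poly q a u) hp hq -big_split /=.
  by apply: eq_bigr => i _; rewrite mderivD /line_poly mmapD scalerDr.
- rewrite {1}/line_poly rmorphM /= derivM -/(line_poly p a u) -/(line_poly q a u) hp hq.
  rewrite big_distrl big_distrr -big_split /=; apply: eq_bigr => i _.
  by rewrite mderivM /line_poly rmorphD !rmorphM /= scalerDr scalerAl scalerAr.
Qed.

Lemma horner0_deriv_line_poly p a u :
  (line_poly p a u)^`().[0] = \sum_i u 0 i * peval (mderiv i p) a.
Proof.
rewrite deriv_line_poly horner_sum; apply: eq_bigr => i _.
by rewrite hornerZ horner_line_poly scale0r addr0.
Qed.

Lemma size_line_poly p : exists d, forall a u, (size (line_poly p a u) <= d.+1)%N.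
Proof.
have [d sd] := size_cline p; exists d => a u.
by rewrite -(size_map_poly rc) map_line_poly sd.
Qed.

(** A coefficient [c < -1] would give a zero at the parameter [- c^-1] in [(0, 1)], against
    [closure_pos_segment]. The last clause differentiates the product at [s = 0]. *)
Lemma line_product_form p a y :
  real_zero_poly a p -> closure (pos_component p a) y ->
  exists cs : seq R, [/\ (size cs < size (line_poly p a (y - a)))%N,
    forall c, c \in cs -> -1 <= c,
    forall s, peval p (a + s *: (y - a)) = peval p a * \prod_(c <- cs) (1 + c * s) &
    \sum_i (y - a) 0 i * peval (mderiv i p) a = peval p a * \sum_(c <- cs) c].
Proof.
move=> rz cly; have [pa _] := rz; set g := line_poly _ _ _.
have g0 : g.[0] = peval p a by rewrite horner_line_poly scale0r addr0.
have [||cs scs gE] := @real_rooted_factor R g.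
- by rewrite g0 gt_eqF.
- move=> z; rewrite map_line_poly rootE horner_cline => /eqP.
  exact: real_zero_ceval rz.
have ev s : peval p (a + s *: (y - a)) = peval p a * \prod_(c <- cs) (1 + c * s).
  rewrite -horner_line_poly -/g gE g0 hornerZ horner_prod; congr (_ * _).
  by apply: eq_bigr => c _; rewrite !hornerE.
exists cs; split => //.
- move=> c cin; rewrite leNgt; apply/negP => c1.
  have c0 : c < 0 by apply: lt_trans c1 _; rewrite oppr_lt0.
  have : 0 < peval p (a + (- c^-1) *: (y - a)).
    apply: closure_pos_segment => //; first by rewrite -pos_componentE.
    rewrite oppr_ge0 invr_le0 (ltW c0) /= -invrN invf_lt1 ?oppr_gt0 //.
    by rewrite ltrNr.
  rewrite ev (big_rem c cin) /= mulrN mulfV ?lt_eqF // subrr mul0r mulr0 ltxx //.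
rewrite -horner0_deriv_line_poly -/g gE derivZ hornerZ g0; congr (_ * _).
elim: cs {scs gE ev} => [|c cs IH]; first by rewrite !big_nil derivC horner0.
rewrite !big_cons derivM hornerD !hornerM IH derivD derivC add0r derivZ derivX.
rewrite horner_prod big1 ?mulr1 => [|c' _]; rewrite !hornerE //.
Qed.
End Faces.

(** * Order of vanishing and products of linear factors *)

Section Multiplicity.
Context {R : realType}.
Implicit Types (q : {poly R}).

Lemma horner_gt0_near0 q : 0 < q.[0] ->
  exists2 tau, 0 < tau & forall t, `|t| < tau -> 0 < q.[t].
Proof.
move=> q0; have : \forall t \near (0 : R), 0 < q.[t].
  exact: (cvgr_gt _ (@continuous_horner R q 0) _ q0).
move=> /nbhs_ballP[tau /= tau0 sub].
exists tau => // t tt; apply: (sub t).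
by rewrite -ball_normE /= sub0r normrN.
Qed.

(** Weak inequalities are passed to the limit [t = 0] in this way, after division by a power of
    [t]. *)
Lemma horner0_ge0 q : (forall t, 0 < t < 1 -> 0 <= q.[t]) -> 0 <= q.[0].
Proof.
move=> qge; rewrite leNgt; apply/negP => q0.
have [|tau tau0 qlt] := @horner_gt0_near0 (- q); first by rewrite hornerN oppr_gt0.
pose t := Num.min tau 1 / 2.
have m0 : 0 < Num.min tau 1 by rewrite lt_min tau0 ltr01.
have t0 : 0 < t by rewrite divr_gt0.
have tm : t < Num.min tau 1 by rewrite /t ltr_pdivrMr // mulr_natr mulr2n ltrDl.
have /andP[tt t1] : (t < tau) && (t < 1) by rewrite -lt_min.
have := qlt t; rewrite gtr0_norm // => /(_ tt); rewrite hornerN oppr_gt0 ltNge.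
by rewrite qge // t0 t1.
Qed.

Definition order_at0 q (m : nat) :=
  exists2 psi : {poly R}, psi.[0] != 0 & q = psi * 'X^m.

Lemma order_at0_exists q : q != 0 -> exists m, order_at0 q m.
Proof.
move=> q0; have [m [psi + qE]] := multiplicity_XsubC q 0.
rewrite q0 /= => psi0; exists m, psi; first by rewrite -rootE.
by rewrite qE subr0.
Qed.

Lemma low_coefs_eq0 q k : (forall j, (j < k)%N -> q`_j = 0) ->
  q = drop_poly k q * 'X^k.
Proof.
move=> lowq; rewrite -[LHS](poly_take_drop k q) (_ : take_poly k q = 0) ?add0r //.
by apply/polyP => i; rewrite coef_take_poly coef0; case: ltnP => // /lowq.
Qed.

Lemma horner0_drop_poly q k : (drop_poly k q).[0] = q`_k.
Proof. by rewrite horner_coef0 coef_drop_poly add0n. Qed.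

(** With [b = c + 1 >= 0] each factor is [(1 + b) / 2], and the product of the [1 + b] is at least
    [1] plus the sum of the [b]. *)
Lemma sum_le_prod_half (cs : seq R) (d : nat) :
  (size cs <= d)%N -> (forall c, c \in cs -> -1 <= c) ->
  (2^-1) ^+ d * (\sum_(c <- cs) c) <= \prod_(c <- cs) (1 + c * 2^-1).
Proof.
move=> sd cge.
have half0 : 0 <= 2^-1 :> R by rewrite invr_ge0.
have H : (2^-1) ^+ size cs * (1 + \sum_(c <- cs) (c + 1)) <=
    \prod_(c <- cs) (1 + c * 2^-1) /\ 0 <= \sum_(c <- cs) (c + 1).
  elim: cs cge {sd} => [|c cs IH] cge; first by rewrite !big_nil expr0 mul1r addr0.
  have c1 : 0 <= c + 1 by rewrite -[1]opprK subr_ge0 cge // mem_head.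
  have [c' c'in|IH1 IH2] := IH; first by rewrite cge // in_cons c'in orbT.
  rewrite !big_cons /=; split; last by rewrite addr_ge0.
  rewrite exprS; set S := \sum_(j <- cs) _ in IH1 IH2 *.
  set P := (\prod_(j <- cs) _) in IH1 *; set h := _ ^+ _ in IH1 *.
  have h0 : 0 <= h by rewrite exprn_ge0.
  apply: (@le_trans _ _ ((1 + c * 2^-1) * (h * (1 + S)))); last first.
    by apply: ler_wpM2l => //; lra.
  have -> : 2^-1 * h * (1 + (c + 1 + S)) = 2^-1 * (h * (1 + (c + 1 + S))) by ring.
  have -> : (1 + c * 2^-1) * (h * (1 + S)) =
    2^-1 * (h * (1 + (c + 1 + S))) + 2^-1 * (h * ((c + 1) * S)) by field.
  by rewrite lerDl !mulr_ge0.
have [H1 H2] := H; set P := \prod_(c <- cs) _ in H1 *.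
have P0 : 0 <= P.
  by apply: le_trans H1; rewrite mulr_ge0 ?exprn_ge0 // addr_ge0.
have [S0|S0] := leP (\sum_(c <- cs) c) 0.
  by rewrite (le_trans _ P0) // mulr_ge0_le0 // exprn_ge0.
apply: le_trans H1; apply: ler_pM; rewrite ?exprn_ge0 ?(ltW S0) //.
  by rewrite ler_wiXn2l // invf_le1 // ler1n.
rewrite big_split /= addrCA lerDl addr_ge0 // sumr_ge0 //.
Qed.

Lemma sum_ge_opp_size (cs : seq R) (d : nat) :
  (size cs <= d)%N -> (forall c, c \in cs -> -1 <= c) ->
  - d%:R <= \sum_(c <- cs) c.
Proof.
move=> sd cge; apply: (@le_trans _ _ (- (size cs)%:R)); first by rewrite lerN2 ler_nat.
elim: cs cge {sd} => [|c cs IH] cge; first by rewrite big_nil oppr0.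
rewrite big_cons /= -addn1 natrD opprD addrC lerD // ?cge ?mem_head //.
by apply: IH => c' c'in; rewrite cge // in_cons c'in orbT.
Qed.

(** The remaining entries contribute at least [- d] to the sum. *)
Lemma mem_le_sum (cs : seq R) (d : nat) (C : R) :
  (size cs <= d)%N -> (forall c, c \in cs -> -1 <= c) -> \sum_(c <- cs) c <= C ->
  forall c, c \in cs -> c <= C + d%:R.
Proof.
move=> sd cge sC c cin.
have [s' s'E] : exists s', perm_eq cs (c :: s') by exists (rem c cs); exact: perm_to_rem.
have ss : size cs = (size s').+1 by rewrite (perm_size s'E).
have ge' : - (size s')%:R <= \sum_(c <- s') c.
  apply: sum_ge_opp_size => // c' c'in.
  by apply: cge; rewrite (perm_mem s'E) in_cons c'in orbT.
move: sC; rewrite (perm_big _ s'E) big_cons => sC.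
have ds : (size s')%:R <= d%:R :> R by rewrite ler_nat (leq_trans _ sd) // ss.
move: sC; rewrite -lerBrDr => /le_trans; apply; rewrite lerD2l lerNl.
by apply: le_trans ge'; rewrite lerN2.
Qed.

End Multiplicity.

(** * The tangent functional at a boundary point *)

Section Tangent.
Context {R : realType} {n : nat}.
Implicit Types (p : mpoly n R) (a e u v w x y : 'rV[R]_n).

Definition ray_poly p e x : {poly R} := line_poly p x (e - x).

(** As a polynomial in [t], the derivative of [p] along [u] at [x + t (e - x)]. Its coefficients are
    linear in [u]; one of them defines the exposing hyperplane. *)
Definition ray_gradient p e x u : {poly R} :=
  \sum_i u 0 i *: line_poly (mderiv i p) x (e - x).

Lemma coef_ray_gradient p e x u k :
  (ray_gradient p e x u)`_k = \sum_i u 0 i * (line_poly (mderiv i p) x (e - x))`_k.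
Proof. by rewrite coef_sum; apply: eq_bigr => i _; rewrite coefZ. Qed.

Lemma coef_ray_gradientD p e x u v k :
  (ray_gradient p e x (u + v))`_k = (ray_gradient p e x u)`_k + (ray_gradient p e x v)`_k.
Proof.
rewrite !coef_ray_gradient -big_split /=.
by apply: eq_bigr => i _; rewrite mxE mulrDl.
Qed.

Lemma coef_ray_gradientZ p e x (s : R) u k :
  (ray_gradient p e x (s *: u))`_k = s * (ray_gradient p e x u)`_k.
Proof.
rewrite !coef_ray_gradient big_distrr /=.
by apply: eq_bigr => i _; rewrite mxE mulrA.
Qed.

Lemma ray_gradient_direction p e x : ray_gradient p e x (e - x) = (ray_poly p e x)^`().
Proof. by rewrite deriv_line_poly. Qed.

Lemma horner_ray_poly p e x t : (ray_poly p e x).[t] = peval p (x + t *: (e - x)).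
Proof. exact: horner_line_poly. Qed.

(** The base point is moved to [a = x + t (e - x)], where [p] is again a real zero polynomial. The
    factor [1 - t] arises from [b - a = (1 - t) (y - x)] with [b = y + t (e - y)]. *)
Lemma ray_product_form p : exists d, forall e x y t,
  real_zero_poly e p -> closure (pos_component p e) x ->
  closure (pos_component p e) y -> 0 < t < 1 ->
  0 < (ray_poly p e x).[t] /\
  exists cs : seq R, [/\ (size cs <= d)%N, forall c, c \in cs -> -1 <= c,
    (1 - t) * (ray_gradient p e x (y - x)).[t] =
      (ray_poly p e x).[t] * \sum_(c <- cs) c &
    forall s, (ray_poly p e (x + s *: (y - x))).[t] =
      (ray_poly p e x).[t] * \prod_(c <- cs) (1 + c * s)].
Proof.
have [d sd] := size_line_poly p; exists d => e x y t rz clx cly /andP[t0 t1].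
pose a := x + t *: (e - x); pose b := y + t *: (e - y).
have t01 : 0 < t <= 1 by rewrite t0 ltW.
have ea : pos_component p e a by exact: closure_component_segment.
have eb : pos_component p e b by exact: closure_component_segment.
have rza := real_zero_component rz ea.
have ab : closure (pos_component p a) b.
  by apply: subset_closure; rewrite /pos_component -(same_connected_component ea).
have bE : b - a = (1 - t) *: (y - x) by apply/rowP => i; rewrite !mxE; ring.
split; first by rewrite horner_ray_poly; exact: connected_component_sub ea.
have [cs [scs cge ev der]] := line_product_form rza ab.
exists cs; split => //.
- by rewrite -ltnS (leq_trans scs (sd _ _)).
- rewrite horner_ray_poly -/a -der horner_sum big_distrr /=; apply: eq_bigr => i _.
  by rewrite hornerZ horner_line_poly -/a bE [in RHS]mxE mulrA.
- move=> s; rewrite !horner_ray_poly -/a -ev; congr peval.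
  by apply/rowP => i; rewrite !mxE; ring.
Qed.

Lemma ray_poly_neq0 p e x : real_zero_poly e p -> ray_poly p e x != 0.
Proof.
move=> [pe _]; apply: contraTneq pe => phi0.
have := horner_ray_poly p e x 1; rewrite phi0 horner0 scale1r subrKC => <-.
by rewrite ltxx.
Qed.

Lemma near_component p a u : 0 < peval p a ->
  exists2 delta : R, 0 < delta &
    forall s, `|s| <= delta -> pos_component p a (a + s *: u).
Proof.
move=> pa; have [|tau tau0 near0] := @horner_gt0_near0 R (line_poly p a u).
  by rewrite horner_line_poly scale0r addr0.
exists (tau / 2) => [|s sd]; first by rewrite divr_gt0.
apply: pos_segment_component => t /andP[t0 t1].
rewrite addrAC subrr add0r scalerA -horner_line_poly near0 // normrM.
rewrite (ger0_norm t0) (le_lt_trans (ler_wpM2r (normr_ge0 s) t1)) // mul1r.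
by rewrite (le_lt_trans sd) // ltr_pdivrMr // mulr_natr mulr2n ltrDl.
Qed.

Lemma closure_along (A : set 'rV[R]_n) x v (tau : R) : 0 < tau ->
  (forall t, 0 < t < tau -> A (x + t *: v)) -> closure A x.
Proof.
move=> tau0 At B Bx.
have cont : (x + t *: v) @[t --> (0 : R)] --> x + 0 *: v.
  apply: cvgD; first exact: cvg_cst.
  exact: cvgZr_tmp.
have : \forall t \near (0 : R), B (x + t *: v).
  by apply: cont; rewrite scale0r addr0.
move=> /nbhs_ballP[r /= r0 sub].
pose t := Num.min r tau / 2.
have m0 : 0 < Num.min r tau by rewrite lt_min r0 tau0.
have t0 : 0 < t by rewrite divr_gt0.
have tm : t < Num.min r tau by rewrite /t ltr_pdivrMr // mulr_natr mulr2n ltrDl.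
have /andP[tr tt] : (t < r) && (t < tau) by rewrite -lt_min.
exists (x + t *: v); split; first by apply: At; rewrite t0.
by apply: (sub t); rewrite -ball_normE /= sub0r normrN gtr0_norm.
Qed.

Context (p : mpoly n R) (e : 'rV[R]_n).
Hypothesis rz : real_zero_poly e p.
Local Notation S := (closure (pos_component p e)).
Local Notation phi := (ray_poly p e).
Local Notation G := (ray_gradient p e).

Lemma closure_component_pos x : S x -> 0 < peval p x -> pos_component p e x.
Proof.
move=> Sx px; rewrite pos_componentE // => t /andP[t0 t1].
have [->|tn1] := eqVneq t 1; first by rewrite scale1r subrKC.
apply: closure_pos_segment => //; first by rewrite -pos_componentE.
by rewrite t0 lt_neqAle tn1.
Qed.

Lemma ray_poly_order_pos x (m : nat) psi : S x -> psi.[0] != 0 ->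
  phi x = psi * 'X^m -> 0 < psi.[0] /\ forall t, 0 < t < 1 -> 0 < psi.[t].
Proof.
move=> Sx psi0 phiE; have [d kd] := ray_product_form p.
have pos t : 0 < t < 1 -> 0 < psi.[t].
  move=> tI; have [phit _] := kd e x x t rz Sx Sx tI.
  move: phit; rewrite phiE hornerM hornerXn pmulr_lgt0 // exprn_gt0 //.
  by case/andP: tI.
split=> //; rewrite lt_neqAle eq_sym psi0 horner0_ge0 // => t /pos; exact: ltW.
Qed.

(** Since all [c >= -1], the polynomial [(1 - t) G] is at least [- d phi] on [(0, 1)], and [phi]
    vanishes to order [m > k]. *)
Lemma first_coef_ge0 x y (m k : nat) : S x -> S y -> order_at0 (phi x) m ->
  (k < m)%N -> (forall j, (j < k)%N -> (G x (y - x))`_j = 0) ->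
  0 <= (G x (y - x))`_k.
Proof.
move=> Sx Sy [psi psi0 phiE] km low.
have [d kd] := ray_product_form p.
have GE := low_coefs_eq0 low; set B := drop_poly k _ in GE.
have B0 : B.[0] = (G x (y - x))`_k by rewrite horner0_drop_poly.
(* [q] is [(1 - t) G + d phi] divided by [t^k]. *)
pose q := (1 - 'X) * B + d%:R *: psi * 'X^(m - k).
have -> : (G x (y - x))`_k = q.[0].
  rewrite -B0 /q !hornerE expr0n subn_eq0 leqNgt km /= mulr0 addr0.
  by rewrite subr0 mul1r.
apply: horner0_ge0 => t tI; have [phit [cs [scs cge der _]]] := kd e x y t rz Sx Sy tI.
have /andP[t0 t1] := tI.
have := ler_wpM2l (ltW phit) (sum_ge_opp_size scs cge).
rewrite -der GE phiE !hornerM !hornerXn => ineq.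
have tk : 0 < t ^+ k by rewrite exprn_gt0.
rewrite -(pmulr_rge0 _ tk) /q !hornerE.
have -> : t ^+ k * ((1 - t) * B.[t] + d%:R * psi.[t] * t ^+ (m - k)) =
  (1 - t) * (B.[t] * t ^+ k) + psi.[t] * (t ^+ (m - k) * t ^+ k) * d%:R by ring.
rewrite -exprD subnK ?(ltnW km) // addrC -lerBlDl sub0r -mulrN //.
Qed.

(* The coefficient functional is nonnegative on [S - x] and vanishes at [e - x],
   which is interior to [S - x]. *)
Lemma low_coef_eq0 x (m k : nat) u : S x -> order_at0 (phi x) m ->
  (k.+1 < m)%N -> (G x u)`_k = 0.
Proof.
move=> Sx ordx; elim/ltn_ind: k u => k IH u km.
have ge0 y : S y -> 0 <= (G x (y - x))`_k.
  move=> Sy; apply: (first_coef_ge0 Sx Sy ordx (ltnW km)) => j jk.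
  by apply: (IH _ jk); rewrite (ltn_trans _ km) // ltnS.
have dir0 : (G x (e - x))`_k = 0.
  rewrite ray_gradient_direction coef_deriv; have [psi _ ->] := ordx.
  by rewrite coefMXn km mul0rn.
have [pe _] := rz; have [delta d0 near_e] := near_component u pe.
have gE s : (G x (e + s *: u - x))`_k = s * (G x u)`_k.
  by rewrite addrAC coef_ray_gradientD dir0 add0r coef_ray_gradientZ.
have h1 := ge0 _ (subset_closure (near_e delta _)).
have h2 := ge0 _ (subset_closure (near_e (- delta) _)).
apply/eqP; rewrite eq_le; apply/andP; split.
  by rewrite -(pmulr_rle0 _ d0) -oppr_ge0 -mulNr -gE h2 // normrN ger0_norm // ltW.
by rewrite -(pmulr_rge0 _ d0) -gE h1 // ger0_norm // ltW.
Qed.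

(** Along [e - x] the gradient is [phi'], whose coefficient of [t^m] is [(m + 1) psi(0)]. *)
Lemma tangent_direction_gt0 x (m : nat) : S x -> order_at0 (phi x) m.+1 ->
  0 < (G x (e - x))`_m.
Proof.
move=> Sx [psi psi0 phiE]; have [psi0' _] := ray_poly_order_pos Sx psi0 phiE.
rewrite ray_gradient_direction coef_deriv phiE coefMXn ltnn subnn pmulrn_rgt0 //.
by rewrite -horner_coef0.
Qed.

Lemma tangent_ge0 x y (m : nat) : S x -> S y -> order_at0 (phi x) m.+1 ->
  0 <= (G x (y - x))`_m.
Proof.
move=> Sx Sy ordx; apply: (first_coef_ge0 Sx Sy ordx) => // j jm.
exact: (low_coef_eq0 _ Sx ordx).
Qed.

End Tangent.

(** * Points on and off the tangent hyperplane, and its complement in the closure *)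

Section Exposing.
Context {R : realType} {n : nat} (p : mpoly n R) (e : 'rV[R]_n).
Hypothesis rz : real_zero_poly e p.
Local Notation S := (closure (pos_component p e)).
Local Notation phi := (ray_poly p e).
Local Notation G := (ray_gradient p e).

(** Now the gradient vanishes at least to the order of [phi], so the sum of the [c], their quotient
    up to [1 - t], stays bounded as [t] tends to [0]. Each [c] is then bounded too, and the product
    stays positive for small negative [s]. *)
Lemma tangent_extends x y (m : nat) : S x -> S y -> order_at0 (phi x) m.+1 ->
  (G x (y - x))`_m = 0 ->
  exists2 eta : R, 0 < eta & S (x - eta *: (y - x)).
Proof.
move=> Sx Sy ordx Gm; have [psi psi0 phiE] := ordx.
have [psi_pos0 psi_pos] := ray_poly_order_pos rz Sx psi0 phiE.
have [d kd] := ray_product_form p.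
have GE : G x (y - x) = drop_poly m.+1 (G x (y - x)) * 'X^(m.+1).
  apply: low_coefs_eq0 => j; rewrite ltnS leq_eqVlt => /orP[/eqP ->//|jm].
  exact: (low_coef_eq0 rz _ Sx ordx).
set B := drop_poly _ _ in GE.
(* The sum of the [c] equals [(1 - t) B / psi], whose value at [0] is less than [C]. *)
pose C := `|B.[0]| / psi.[0] + 1.
have C0 : 0 <= C by rewrite addr_ge0 // divr_ge0 // ltW.
have [|tau tau0 near0] := @horner_gt0_near0 R (C *: psi - (1 - 'X) * B).
  rewrite !hornerE subr0 mul1r mulrDl mul1r divfK // subr_gt0.
  by rewrite (le_lt_trans (ler_norm _)) // ltrDl.
(* Every [c] is at most [C + d], so [c eta < 1] and the factors [1 - c eta r] are positive for [r]
   in [[0, 1]]. *)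
pose eta := (C + d%:R + 1)^-1.
have D0 : 0 < C + d%:R + 1 by rewrite ltr_wpDl // addr_ge0.
have eta0 : 0 < eta by rewrite invr_gt0.
have pos t r : 0 < t < Num.min tau 1 -> 0 <= r <= 1 ->
    0 < (phi (x + (- (eta * r)) *: (y - x))).[t].
  rewrite lt_min => /and3P[t0 tt t1] /andP[r0 r1].
  have tI : 0 < t < 1 by rewrite t0.
  have [phit [cs [scs cge der ->]]] := kd e x y t rz Sx Sy tI.
  have sumC : \sum_(c <- cs) c <= C.
    have tm : 0 < t ^+ m.+1 by rewrite exprn_gt0.
    have := near0 t; rewrite gtr0_norm // => /(_ tt).
    rewrite !hornerE subr_gt0 => ineq.
    have E : psi.[t] * \sum_(c <- cs) c = (1 - t) * B.[t].
      apply: (mulIf (lt0r_neq0 tm)); rewrite mulrAC.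
      move: der; rewrite {1}GE phiE !hornerM !hornerXn => <-.
      by rewrite mulrA.
    rewrite -(ler_pM2l (psi_pos t tI)) E ltW //.
    by rewrite (mulrC psi.[t]).
  rewrite mulr_gt0 // big_seq prodr_gt0 // => c cin.
  have cC := mem_le_sum scs cge sumC cin.
  rewrite mulrN subr_gt0.
  have [c0|c0] := leP c 0.
    by rewrite (le_lt_trans _ ltr01) // mulr_le0_ge0 // mulr_ge0 // ltW.
  rewrite (@le_lt_trans _ _ (c * eta)) //.
    by rewrite ler_wpM2l ?(ltW c0) // ler_piMr // ltW.
  by rewrite /eta ltr_pdivrMr // mul1r (le_lt_trans cC) // ltrDl.
exists eta => //.
have m0 : 0 < Num.min tau 1 by rewrite lt_min tau0 ltr01.
(* For small [t] and [z = x - eta (y - x)], the segment from [x + t (e - x)] to [z + t (e - z)]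
   stays in [p > 0]; then [t] tends to [0]. *)
apply: (@closure_along R n _ _ (e - (x - eta *: (y - x))) _ m0) => t tI.
have t01 : 0 < t <= 1.
  by move: tI; rewrite lt_min => /and3P[-> _ /ltW ->].
have ea := closure_component_segment rz Sx t01.
apply: (connected_component_trans ea); apply: pos_segment_component => r rI.
have := pos t r tI rI; rewrite horner_ray_poly.
by congr (0 < peval p _); apply/rowP => i; rewrite !mxE; ring.
Qed.

(** By [sum_le_prod_half], [phi] at the midpoint is at least [2^-d (1 - t) G], which has order [m]
    with positive leading term at [0]. *)
Lemma order_drop x y (m m' : nat) : S x -> S y -> order_at0 (phi x) m.+1 ->
  0 < (G x (y - x))`_m -> order_at0 (phi (x + 2^-1 *: (y - x))) m' -> (m' <= m)%N.
Proof.
move=> Sx Sy ordx Gm [psi psi0 phizE]; rewrite leqNgt; apply/negP => mm'.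
have [d kd] := ray_product_form p.
have GE : G x (y - x) = drop_poly m (G x (y - x)) * 'X^m.
  by apply: low_coefs_eq0 => j jm; exact: (low_coef_eq0 rz _ Sx ordx).
set B := drop_poly _ _ in GE.
have B0 : B.[0] = (G x (y - x))`_m by rewrite horner0_drop_poly.
(* [q] is the difference of the two sides divided by [t^m]; for [m' > m] its value at [0] would be
   negative. *)
pose q := psi * 'X^(m' - m) - (2^-1) ^+ d *: ((1 - 'X) * B).
have : 0 <= q.[0].
  apply: horner0_ge0 => t tI; have /andP[t0 t1] := tI.
  have [phit [cs [scs cge der ev]]] := kd e x y t rz Sx Sy tI.
  have tm : 0 < t ^+ m by rewrite exprn_gt0.
  have := ler_wpM2l (ltW phit) (sum_le_prod_half scs cge).
  rewrite -ev mulrCA -der GE phizE !hornerM !hornerXn => ineq.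
  rewrite -(pmulr_rge0 _ tm) /q !hornerE mulrBr subr_ge0.
  have -> : t ^+ m * (psi.[t] * t ^+ (m' - m)) = psi.[t] * (t ^+ (m' - m) * t ^+ m) by ring.
  rewrite -exprD subnK ?(ltnW mm') //; apply: le_trans ineq.
  by rewrite le_eqVlt /=; apply/orP; left; apply/eqP; ring.
rewrite /q !hornerE /= subr0 mulr1 expr0n subn_eq0 leqNgt mm' /= mulr0 sub0r B0.
by rewrite oppr_ge0 leNgt mulr_gt0 // exprn_gt0 // invr_gt0.
Qed.

(** [x] is a proper convex combination of [x - eta (y - x)] and [y], with weight [(1 + eta)^-1] on
    the former. *)
Lemma face_contains_segment (F : set 'rV[R]_n) x y (eta : R) : is_face S F ->
  F x -> S y -> 0 < eta -> S (x - eta *: (y - x)) -> F y.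
Proof.
move=> [_ _ _ face] Fx Sy eta0 Sz.
have D0 : 0 < 1 + eta by rewrite addr_gt0.
have Dn0 : 1 + eta != 0 by rewrite gt_eqF.
have [|||_ //] := face _ y (1 + eta)^-1 Sz Sy.
- by rewrite invr_gt0.
- by rewrite invf_lt1 // ltrDl.
- have -> // : (1 + eta)^-1 *: (x - eta *: (y - x)) + (1 - (1 + eta)^-1) *: y = x.
  by apply/rowP => i; rewrite !mxE; field.
Qed.

Lemma face_midpoint (F : set 'rV[R]_n) x y : is_face S F -> F x -> F y ->
  F (x + 2^-1 *: (y - x)).
Proof.
move=> [_ cF _ _] Fx Fy.
have h0 : 0 <= 2^-1 :> R by rewrite invr_ge0.
have h1 : 2^-1 <= 1 :> R by rewrite invf_le1 // ler1n.
have := cF x y (Itv01 h0 h1); rewrite !inE => /(_ Fx Fy).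
have -> : x + 2^-1 *: (y - x) = 2^-1 *: x + (1 - 2^-1) *: y.
  by apply/rowP => i; rewrite !mxE; field.
by [].
Qed.

(** The set is star-shaped about [e]: an affine function positive at both ends of a segment is
    positive on it. *)
Lemma closure_component_minus_hyperplane_connected (L : 'rV[R]_n -> R) :
  (forall x y (t : R), L (x + t *: (y - x)) = L x + t * (L y - L x)) ->
  0 < L e -> (forall x, S x -> 0 <= L x) -> connected [set x | S x /\ L x != 0].
Proof.
move=> Laff Le Lge.
have -> : [set x | S x /\ L x != 0] = \bigcup_(x in [set x | S x /\ L x != 0])
    [set e + t *: (x - e) | t in `[0, 1]%classic : set R].
  apply/seteqP; split => [x xS|z [x [Sx Lx] [t tI <-]]].
    by exists x => //; exists 1; rewrite /= ?in_itv /= ?ler01 ?lexx // scale1r subrKC.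
  move: tI; rewrite /= in_itv /= => /andP[t0 t1].
  have Lxp : 0 < L x by rewrite lt_neqAle eq_sym Lx Lge.
  split.
    have [->|tn1] := eqVneq t 1; first by rewrite scale1r subrKC.
    have -> : e + t *: (x - e) = x + (1 - t) *: (e - x).
      by apply/rowP => i; rewrite !mxE; ring.
    apply: subset_closure; apply: closure_component_segment => //.
    by rewrite subr_gt0 lt_neqAle tn1 t1 /= gerBl.
  rewrite Laff gt_eqF //.
  have [->|tn0] := eqVneq t 0; first by rewrite mul0r addr0.
  have tp : 0 < t by rewrite lt_neqAle eq_sym tn0.
  have := mulr_gt0 tp Lxp; have : 0 <= (1 - t) * L e by rewrite mulr_ge0 ?(ltW Le) ?subr_ge0.
  by lra.
apply: bigcup_connected => [|x _]; last exact: segment_rV_connected.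
exists e => x [Sx Lx]; exists 0; rewrite /= ?in_itv /= ?ler01 ?lexx //.
by rewrite scale0r addr0.
Qed.

End Exposing.

(** * Exposing a face at a point of least order of vanishing *)

Lemma exists_minimal_nat (P : nat -> Prop) : (exists k, P k) ->
  exists2 k, P k & forall k', P k' -> (k <= k')%N.
Proof.
move=> exP; have exP' : exists k, `[< P k >] by have [k Pk] := exP; exists k; apply/asboolP.
case: (ex_minnP exP') => k /asboolP Pk kmin; exists k => // k' Pk'.
by apply: kmin; apply/asboolP.
Qed.

Theorem corollary2p5 (R : realType) (n : nat) (S : set 'rV[R]_n) :
  rigidly_convex S ->
  forall F : set 'rV[R]_n, is_face S F -> exposed_face S F.
Proof.
move=> [e [p [_ rz SE]]] F; rewrite {}SE -/(pos_component p e) => faceF.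
split=> //; have [[x0 Fx0] cF FS face] := faceF.
have [|m [x Fx ordx] minm] := exists_minimal_nat
    (P := fun m => exists2 x, F x & order_at0 (ray_poly p e x) m).
  by have [m ordm] := order_at0_exists (ray_poly_neq0 x0 rz); exists m, x0.
have Sx := FS _ Fx.
case: m => [|m] in ordx minm *.
  (* Order [0] means [p(x) > 0], so [x] is interior and every segment from a point of [S] to [x]
     extends beyond [x]. *)
  left; apply/seteqP; split => // y Sy.
  have px : 0 < peval p x.
    have [psi psi0 phiE] := ordx; have [psi0' _] := ray_poly_order_pos rz Sx psi0 phiE.
    have := horner_ray_poly p e x 0; rewrite phiE scale0r addr0 => <-.
    by rewrite expr0 mulr1.
  have ex := closure_component_pos rz Sx px.
  have [delta d0 near_x] := near_component (y - x) px.
  apply: (face_contains_segment faceF Fx Sy d0); apply: subset_closure.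
  rewrite -scaleNr; apply: (connected_component_trans ex); apply: near_x.
  by rewrite normrN gtr0_norm.
right; pose G := ray_gradient p e x.
pose a : 'rV[R]_n := \row_i (line_poly (mderiv i p) x (e - x))`_m.
have aG (u : 'rV[R]_n) : \sum_(i < n) a 0 i * u 0 i = (G u)`_m.
  by rewrite coef_ray_gradient; apply: eq_bigr => i _; rewrite mxE mulrC.
have GB (y : 'rV[R]_n) : (G (y - x))`_m = (G y)`_m - (G x)`_m.
  by rewrite coef_ray_gradientD -scaleN1r coef_ray_gradientZ mulN1r.
have Ge := tangent_direction_gt0 rz Sx ordx.
have Gge y (Sy : closure (pos_component p e) y) := tangent_ge0 rz Sx Sy ordx.
pose H := [set z : 'rV[R]_n | \sum_(i < n) a 0 i * z 0 i = (G x)`_m].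
have HE (z : 'rV[R]_n) : H z <-> (G (z - x))`_m = 0.
  by rewrite /H /= aG GB; split => [->|/eqP]; rewrite ?subrr // subr_eq0 => /eqP.
have Hx : H x by apply/HE; rewrite GB subrr.
exists H; split; last first.
  apply/seteqP; split => y.
    move=> [/HE Hy Sy]; have [eta eta0 Sz] := tangent_extends rz Sx Sy ordx Hy.
    exact: (face_contains_segment faceF Fx Sy eta0).
  move=> Fy; have Sy := FS _ Fy; split=> //; apply/HE/eqP.
  rewrite eq_le Gge // andbT leNgt; apply/negP => Gy.
  (* The midpoint lies in [F] and would have order at most [m], against the minimality of [m.+1]. *)
  have Fz := face_midpoint faceF Fx Fy.
  have [m' ordz] := order_at0_exists (ray_poly_neq0 (x + 2^-1 *: (y - x)) rz).
  have := order_drop rz Sx Sy ordx Gy ordz.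
  rewrite leqNgt minm //; exists (x + 2^-1 *: (y - x)) => //.
split.
(* The normal vector is nonzero because the functional is positive at [e - x]. *)
- exists a, (G x)`_m; split => //; apply: contraTneq Ge => a0.
  by rewrite -aG a0 big1 ?ltxx // => i _; rewrite mxE mul0r.
- by exists x.
- rewrite (_ : _ `\` H = [set y | closure (pos_component p e) y /\ (G (y - x))`_m != 0]).
    apply: (closure_component_minus_hyperplane_connected rz) => // y z t.
    rewrite !GB [in LHS]coef_ray_gradientD coef_ray_gradientZ.
    rewrite coef_ray_gradientD -scaleN1r coef_ray_gradientZ; ring.
  apply/seteqP; split => y [Sy Hy]; split => //.
    by apply/eqP => /HE.
  by move=> /HE/eqP; apply/negP.
Qed.
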